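(* For every $\varepsilon>0$ there exists $c>0$ such that the following holds. Let $G$ be a $d$-regular graph on $n$ vertices, where $d\in[(\frac12+\varepsilon)n,(1-\varepsilon)n]$. Then $$\mathrm{surplus}(G)\geq \frac{c\,n^{5/4}}{\log n}.$$
   Context: For a graph $G$ with $m$ edges, $\mathrm{surplus}(G)$ is the maximum $s$ such that $V(G)$ has a partition into two parts with $m/2+s$ edges between the parts (i.e. the maximum cut size minus $m/2$). *)

(* Defs.v *)
From mathcomp Require Import all_boot all_order all_algebra.
From mathcomp Require Import reals.

Set Implicit Arguments.
Unset Strict Implicit.
Unset Printing Implicit Defensive.

Import Order.TTheory GRing.Theory Num.Theory.
Local Open Scope ring_scope.

(* A finite simple graph on the vertex type T is given by its adjacency
   relation, a symmetric irreflexive [e : rel T]. *)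

Definition simple_graph (T : finType) (e : rel T) : Prop :=
  symmetric e /\ irreflexive e.

Definition regular (T : finType) (e : rel T) (d : nat) : Prop :=
  forall x : T, #|[set y | e x y]| = d.

(* Edges are unordered pairs, so each is counted once. *)
Definition edges (T : finType) (e : rel T) : {set {set T}} :=
  [set f : {set T} | [exists x, exists y, e x y && (f == [set x; y])]].

Definition cut (T : finType) (e : rel T) (A : {set T}) : {set {set T}} :=
  [set f in edges e | (f :&: A != set0) && (f :&: ~: A != set0)].

Definition maxcut (T : finType) (e : rel T) : nat :=
  \max_(A : {set T}) #|cut e A|.

Definition surplus (R : realType) (T : finType) (e : rel T) : R :=
  (maxcut e)%:R - #|edges e|%:R / 2.

(* Main.v *)
Require Import Defs.
From mathcomp Require Import all_boot all_order all_algebra.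
From mathcomp Require Import complex spectral sesquilinear ring lra.
From mathcomp Require Import reals sequences exp.

Set Implicit Arguments.
Unset Strict Implicit.
Unset Printing Implicit Defensive.

Import Order.TTheory GRing.Theory Num.Theory.
Local Open Scope ring_scope.

(** Let [s] be the surplus and [A] the adjacency matrix. A cut is a sign vector
    [x], and [- x^T A x <= 4 s]; multilinearity extends this to
    [- x^T A x <= 4 s max_i x_i^2] for every real [x]. Averaging over random
    signed sums of vectors [v_i] of norm at most [1] gives
    [- <A, Gram v> <= C (ln n)^2 s]. After centering the [v_i], regularity
    replaces [- A] by the matrix [N = rho J - I - A], [rho = (d + 1) / n], of
    vanishing row sums and entries in [{rho, rho - 1}]: thus
    [<N, X> <= B max_i X_ii] for every Gram matrix [X], with [B = C' (ln n)^2 s].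

    Write [N = Y - Z] with [Y] and [Z] the positive and negative parts. Testing
    with the projection onto the positive eigenspace gives [tr Y <= B], hence
    [Y_ii = O(B / n)] outside a small proportion of the indices, which are
    discarded. If [|Y|_F^2] is of order [n^2], testing with [Y] itself gives
    [n^2 = O(B^2 / n)]. Otherwise test with the entrywise square [Z o Z], which
    is again a Gram matrix: [<N, Z o Z>] is close to [sum_ij N_ij^3], which
    equals [(2 rho - 1) rho (1 - rho) n^2] and is of order [n^2] because
    [rho > 1/2], so [n^2 = O(B (B / n + 1)^2)]. In both cases [B] is at least of
    order [n^(4/3)], which is more than needed. *)

(** * Spectral decomposition of real symmetric matrices *)

Section HermitianSpectral.
Local Open Scope sesquilinear_scope.
Variables (C : numClosedFieldType) (n : nat).

Lemma hermitian_diagonalization (A : 'M[C]_n) : A \is hermsymmx ->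
  exists (P : 'M[C]_n) (d : 'rV[C]_n),
    [/\ P *m P^t* = 1%:M, P^t* *m P = 1%:M, d \is a realmx,
        A = P^t* *m diag_mx d *m P & A *m P^t* = P^t* *m diag_mx d].
Proof.
move=> Aherm; have /hermitian_normalmx/orthomx_spectralP := Aherm.
set P := spectralmx A; set d := spectral_diag A => AE.
have Punit : P \is unitarymx by exact: spectral_unitarymx.
have PPt : P *m P^t* = 1%:M by apply/unitarymxP.
have AE' : A = P^t* *m diag_mx d *m P by rewrite {1}AE invmx_unitary.
exists P, d; split => //.
- exact: mulmx1C.
- exact: hermitian_spectral_diag_real.
- by rewrite {1}AE' -[LHS]mulmxA PPt mulmx1.
Qed.

(** As [f] is real, [F] is Hermitian, so the left side is the trace of the square of [F], and
    cyclicity of the trace reduces it to the squared diagonal. *)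
Lemma frobenius_unitary_conj (P : 'M[C]_n) (f : 'rV[C]_n) :
  P *m P^t* = 1%:M -> f \is a realmx ->
  let F := P^t* *m diag_mx f *m P in
  \sum_i \sum_j F i j * (F i j)^* = \sum_k f 0 k ^+ 2.
Proof.
move=> PPt freal F.
have FJ : F^t* = F.
  rewrite /F !trmx_mul !map_mxM trmxCK mulmxA tr_diag_mx map_diag_mx.
  by rewrite (realmxC freal).
transitivity (\tr (F *m F^t*)).
  by apply: eq_bigr => i _; rewrite mxE; apply: eq_bigr => j _; rewrite !mxE.
have FF : F *m F^t* = P^t* *m (diag_mx f *m diag_mx f *m P).
  by rewrite FJ /F -[LHS]mulmxA [P *m _]mulmxA [P *m _]mulmxA PPt mul1mx !mulmxA.
rewrite FF mxtrace_mulC -[X in \tr X]mulmxA PPt mulmx1 mulmx_diag mxtrace_diag.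
by apply: eq_bigr => k _; rewrite !mxE.
Qed.

End HermitianSpectral.

Section SymmetricSpectral.
Variable R : realType.
Local Notation C := R[i].
Local Open Scope sesquilinear_scope.

Lemma Re_sum (I : finType) (F : I -> C) :
  complex.Re (\sum_i F i) = \sum_i complex.Re (F i).
Proof. exact: (raddf_sum (@complex.Re R : Rcomplex R -> R)). Qed.

Lemma Im_sum (I : finType) (F : I -> C) :
  complex.Im (\sum_i F i) = \sum_i complex.Im (F i).
Proof. exact: (raddf_sum (@complex.Im R : Rcomplex R -> R)). Qed.

Lemma ReMJ (x y : C) : complex.Re (x^* * y) =
  complex.Re x * complex.Re y + complex.Im x * complex.Im y.
Proof. by case: x y => [a b] [c d] /=; ring. Qed.

Lemma ReZ (x : R) (z : C) : complex.Re (x%:C%C * z) = x * complex.Re z.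
Proof. by case: z => u v /=; ring. Qed.

Lemma ImZ (x : R) (z : C) : complex.Im (x%:C%C * z) = x * complex.Im z.
Proof. by case: z => u v /=; ring. Qed.

(* [a i k] and [b i k] are the real and imaginary parts of a complex orthonormal
   eigenbasis; the last clause is only an inequality because the imaginary part
   of the recombined matrix is dropped. *)
Lemma symmetric_eigenframe_ord n (M : 'I_n -> 'I_n -> R) :
  (forall i j, M i j = M j i) ->
  exists (a b : 'I_n -> 'I_n -> R) (l : 'I_n -> R),
  [/\ forall i j, M i j = \sum_k l k * (a i k * a j k + b i k * b j k),
      forall i, \sum_k (a i k ^+ 2 + b i k ^+ 2) = 1,
      forall k, \sum_i (a i k ^+ 2 + b i k ^+ 2) = 1,
      forall i k, \sum_j M i j * a j k = l k * a i k /\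
                  \sum_j M i j * b j k = l k * b i k &
      forall f : 'I_n -> R,
        \sum_i \sum_j (\sum_k f k * (a i k * a j k + b i k * b j k)) ^+ 2
        <= \sum_k f k ^+ 2].
Proof.
move=> Msym; pose A : 'M[C]_n := \matrix_(i, j) (M i j)%:C%C.
have Aherm : A \is hermsymmx.
  apply/is_hermitianmxP; rewrite expr0 scale1r; apply/matrixP => i j.
  by rewrite !mxE Msym; exact/esym/conjc_real.
have [P [d [PPt PtP dreal AE AP]]] := hermitian_diagonalization Aherm.
pose l k := complex.Re (d 0 k).
have dE k : d 0 k = (l k)%:C%C.
  by rewrite /l RRe_real//; have /mxOverP := dreal; apply.
exists (fun i k => complex.Re (P k i)), (fun i k => complex.Im (P k i)), l.
have ReF (f : 'rV[C]_n) (g : 'I_n -> R) i j : (forall k, f 0 k = (g k)%:C%C) ->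
    complex.Re ((P^t* *m diag_mx f *m P) i j) =
    \sum_k g k * (complex.Re (P k i) * complex.Re (P k j)
                  + complex.Im (P k i) * complex.Im (P k j)).
  move=> fE; rewrite mxE Re_sum; apply: eq_bigr => k _.
  by rewrite mul_mx_diag !mxE fE -ReMJ -mulrA mulrCA ReZ.
have sqE (x : C) : complex.Re x ^+ 2 + complex.Im x ^+ 2 = complex.Re (x^* * x).
  by rewrite ReMJ.
split.
- by move=> i j; rewrite -(ReF d)// -AE mxE.
- move=> i; have := congr1 (fun A : 'M[C]_n => complex.Re (A i i)) PtP.
  rewrite !mxE eqxx /= Re_sum => <-; apply: eq_bigr => k _.
  by rewrite sqE !mxE.
- move=> k; have := congr1 (fun A : 'M[C]_n => complex.Re (A k k)) PPt.
  rewrite !mxE eqxx /= Re_sum => <-; apply: eq_bigr => i _.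
  by rewrite sqE !mxE mulrC.
- move=> i k; have /matrixP/(_ i k) := AP; rewrite mul_mx_diag !mxE dE => e.
  split.
    have := congr1 (@complex.Re R) e; rewrite Re_sum [_ * (l k)%:C%C]mulrC ReZ.
    have -> : complex.Re (P k i)^* = complex.Re (P k i) by case: (P k i).
    move=> <-; apply: eq_bigr => j _; rewrite !mxE ReZ.
    by case: (P k j).
  have := congr1 (@complex.Im R) e; rewrite Im_sum [_ * (l k)%:C%C]mulrC ImZ.
  have ImJ j : complex.Im (P k j)^* = - complex.Im (P k j) by case: (P k j).
  rewrite ImJ mulrN => /(congr1 -%R); rewrite opprK => <-.
  rewrite -sumrN; apply: eq_bigr => j _.
  by rewrite !mxE ImZ ImJ mulrN opprK.
move=> f; pose fr : 'rV[C]_n := \row_k (f k)%:C%C.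
have frE k : fr 0 k = (f k)%:C%C by rewrite mxE.
have frreal : fr \is a mxOver Num.real.
  by apply/mxOverP => i k; rewrite ord1 frE; apply/complex_realP; exists (f k).
have := frobenius_unitary_conj PPt frreal.
move=> /(congr1 (@complex.Re R)); rewrite !Re_sum => /esym.
under eq_bigr => k _ do rewrite frE expr2 ReZ /= -expr2.
move=> ->; apply: ler_sum => i _; rewrite Re_sum; apply: ler_sum => j _.
by rewrite -(ReF fr)// mulrC -sqE lerDl sqr_ge0.
Qed.

Lemma sum_enum_val (T : finType) (F : T -> R) :
  \sum_x F x = \sum_(i < #|T|) F (enum_val i).
Proof. by rewrite (reindex (@enum_val T T)) //; exact/onW_bij/enum_val_bij. Qed.

Lemma symmetric_eigenframe (T : finType) (M : T -> T -> R) :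
  (forall i j, M i j = M j i) ->
  exists (n : nat) (a b : T -> 'I_n -> R) (l : 'I_n -> R),
  [/\ forall i j, M i j = \sum_k l k * (a i k * a j k + b i k * b j k),
      forall i, \sum_k (a i k ^+ 2 + b i k ^+ 2) = 1,
      forall k, \sum_i (a i k ^+ 2 + b i k ^+ 2) = 1,
      forall i k, \sum_j M i j * a j k = l k * a i k /\
                  \sum_j M i j * b j k = l k * b i k &
      forall f : 'I_n -> R,
        \sum_i \sum_j (\sum_k f k * (a i k * a j k + b i k * b j k)) ^+ 2
        <= \sum_k f k ^+ 2].
Proof.
move=> Msym; pose M' (i j : 'I_#|T|) := M (enum_val i) (enum_val j).
have M'sym i j : M' i j = M' j i by exact: Msym.
have [a [b [l [ME row_norm col_norm eigen bessel]]]] :=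
  symmetric_eigenframe_ord M'sym.
exists #|T|, (fun x => a (enum_rank x)), (fun x => b (enum_rank x)), l; split.
- by move=> x y; rewrite -ME /M' !enum_rankK.
- by [].
- move=> k; rewrite sum_enum_val -(col_norm k).
  by apply: eq_bigr => i _; rewrite enum_valK.
- move=> x k; have [ea eb] := eigen (enum_rank x) k.
  split; rewrite sum_enum_val; [rewrite -ea | rewrite -eb];
    by apply: eq_bigr => i _; rewrite enum_valK /M' enum_rankK.
- move=> f; apply: le_trans (bessel f); rewrite sum_enum_val le_eqVlt.
  apply/orP; left; apply/eqP; apply: eq_bigr => i _; rewrite sum_enum_val.
  by apply: eq_bigr => j _; rewrite !enum_valK.
Qed.

End SymmetricSpectral.

(** Positive semidefinite matrices are handled through such factorizations: the rows of [V] are the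
    vectors to be rounded, and restricting the indices or squaring entrywise acts directly on
    them. *)
Definition gram (R : realType) (T K : finType) (V : T -> K -> R) (i j : T) : R :=
  \sum_k V i k * V j k.

Section SpectralParts.
Variable R : realType.

(** [V], [W] and [P] factor the positive part, the negative part and the projection onto the
    positive eigenspace. The inner product of [M] with [f(M)] is the sum of [f(l) l] over the
    eigenvalues [l], which evaluates the sums involving [M]. *)
Lemma symmetric_spectral_parts (T : finType) (M : T -> T -> R) :
  (forall i j, M i j = M j i) ->
  exists (K : finType) (V W P : T -> K -> R),
  [/\ forall i j, M i j = gram V i j - gram W i j,
      \sum_i \sum_j gram V i j ^+ 2 <= \sum_i \sum_j M i j * gram V i j,
      forall i, gram P i i <= 1 &
      \sum_i \sum_j M i j * gram P i j = \sum_i gram V i i].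
Proof.
move=> /symmetric_eigenframe
  [n [a [b [l [ME row_norm col_norm eigen bessel]]]]].
(* Each complex eigenvector yields two real coordinates, its real and imaginary parts, whence the
   index type ['I_n + 'I_n]. *)
pose fr (f : 'I_n -> R) (i : T) (k : 'I_n + 'I_n) : R :=
  match k with inl k => Num.sqrt (f k) * a i k
             | inr k => Num.sqrt (f k) * b i k end.
have gramE (f : 'I_n -> R) i j : (forall k, 0 <= f k) ->
    gram (fr f) i j = \sum_k f k * (a i k * a j k + b i k * b j k).
  move=> f0; rewrite /gram big_sumType /= -big_split /=; apply: eq_bigr => k _.
  by rewrite -[in RHS](sqr_sqrtr (f0 k)); ring.
have innerE (f : 'I_n -> R) : (forall k, 0 <= f k) ->
    \sum_i \sum_j M i j * gram (fr f) i j = \sum_k f k * l k.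
  move=> f0; transitivity (\sum_i \sum_k
      f k * (a i k * (l k * a i k) + b i k * (l k * b i k))).
    apply: eq_bigr => i _.
    under eq_bigr => j _ do rewrite gramE// big_distrr /=.
    rewrite exchange_big /=; apply: eq_bigr => k _.
    have [<- <-] := eigen i k; rewrite !big_distrr /= -big_split big_distrr /=.
    by apply: eq_bigr => j _; ring.
  rewrite exchange_big /=; apply: eq_bigr => k _.
  rewrite -big_distrr /=; congr (_ * _).
  rewrite -[RHS]mulr1 -(col_norm k) big_distrr /=.
  by apply: eq_bigr => i _; ring.
pose pos k : R := Num.max (l k) 0; pose neg k : R := Num.max (- l k) 0.
pose ind k : R := (0 < l k)%R%:R.
have pos0 k : 0 <= pos k by rewrite le_max lexx orbT.
have neg0 k : 0 <= neg k by rewrite le_max lexx orbT.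
have ind0 k : 0 <= ind k by exact: ler0n.
exists ('I_n + 'I_n)%type, (fr pos), (fr neg), (fr ind); split.
- move=> i j; rewrite !gramE// ME -sumrB; apply: eq_bigr => k _.
  by rewrite -mulrBl /pos /neg; congr (_ * _); case: ltrP => ?; case: ltrP => ?; lra.
- rewrite innerE//; under eq_bigr => i _ do under eq_bigr => j _ do rewrite gramE//.
  apply: le_trans (bessel pos) _; apply: ler_sum => k _.
  by rewrite /pos expr2; case: (ltrP (l k) 0) => _; rewrite ?mul0r.
- move=> i; rewrite gramE// -(row_norm i); apply: ler_sum => k _.
  rewrite -!expr2 ler_piMl ?addr_ge0 ?sqr_ge0 //.
  by rewrite /ind lern1 leq_b1.
- rewrite innerE//; under [RHS]eq_bigr => i _ do rewrite gramE//.
  rewrite exchange_big /=; apply: eq_bigr => k _.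
  rewrite -big_distrr /=.
  under eq_bigr => i _ do rewrite -!expr2.
  by rewrite col_norm mulr1 /ind /pos; case: (ltrP 0 (l k)); rewrite ?mul1r ?mul0r.
Qed.

End SpectralParts.

(** * Cuts and the adjacency form *)

(** The map [f] from ordered adjacent pairs to edges is two-to-one, irreflexivity keeping the two
    preimages distinct. *)
Lemma sum_adjacency (T : finType) (e : rel T) : simple_graph e ->
  (\sum_x \sum_y (e x y : nat) = 2 * #|edges e|)%N.
Proof.
move=> [e_sym e_irr].
pose f (p : T * T) : {set T} := [set p.1; p.2].
have fE p : e p.1 p.2 -> f p \in edges e.
  move=> ep; rewrite inE; apply/existsP; exists p.1.
  by apply/existsP; exists p.2; rewrite ep /=.
rewrite pair_big /=.
rewrite (eq_bigr (fun p : T * T => if e p.1 p.2 then 1 else 0)%N); last first.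
  by move=> p _; case: (e _ _).
rewrite -big_mkcond /= (partition_big f (mem (edges e))) //=.
transitivity (\sum_(E in edges e) 2)%N; last by rewrite sum_nat_const mulnC.
apply: eq_bigr => E; rewrite inE => /existsP[x /existsP[y /andP[exy /eqP ->]]].
have neq : x != y by apply: contraTneq exy => ->; rewrite e_irr.
rewrite sum1dep_card.
suff -> : [set p : T * T | e p.1 p.2 & f p == [set x; y]] = [set (x, y); (y, x)].
  by rewrite cards2 xpair_eqE negb_and neq.
apply/setP => -[u v]; rewrite !inE !xpair_eqE /f /=.
apply/idP/idP; last first.
  by case/orP => /andP[/eqP-> /eqP->]; rewrite ?exy ?eqxx // e_sym exy setUC eqxx.
case/andP => euv /eqP/setP uvxy.
have uv : u != v by apply: contraTneq euv => ->; rewrite e_irr.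
have := uvxy u; have := uvxy v; rewrite !inE !eqxx orbT /=.
move=> /esym/orP vxy /esym/orP uxy.
by case: vxy uxy uv => /eqP-> [] /eqP->; rewrite ?eqxx ?orbT.
Qed.

Lemma sum_adjacencyR (R : realType) (T : finType) (e : rel T) : simple_graph e ->
  \sum_x \sum_y (e x y)%:R = 2 * #|edges e|%:R :> R.
Proof.
move=> /sum_adjacency/(congr1 (fun m => m%:R : R)); rewrite natrM natr_sum => <-.
by apply: eq_bigr => x _; rewrite natr_sum.
Qed.

Section Cuts.
Variables (T : finType) (e : rel T).

(** Seen as the edge set of a subgraph, a cut can be counted by [sum_adjacency] too. *)
Lemma cut_edges (A : {set T}) :
  Defs.cut e A = edges (fun x y => e x y && ((x \in A) (+) (y \in A))).
Proof.
have inter2 (B : {set T}) x y :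
    ([set x; y] :&: B != set0) = (x \in B) || (y \in B).
  apply/set0Pn/orP => [[z]|]; first by rewrite !inE => /andP[/orP[]/eqP->]; tauto.
  by case=> h; [exists x | exists y]; rewrite !inE eqxx ?orbT.
apply/setP => E; rewrite !inE; apply/andP/existsP.
  case=> /existsP[x /existsP[y /andP[exy /eqP ->]]].
  rewrite !inter2 !inE => h; exists x; apply/existsP; exists y.
  by rewrite exy eqxx andbT /=; move: h; case: (x \in A); case: (y \in A).
case=> x /existsP[y /andP[/andP[exy h] /eqP ->]]; split.
  by apply/existsP; exists x; apply/existsP; exists y; rewrite exy eqxx.
by rewrite !inter2 !inE; move: h; case: (x \in A); case: (y \in A).
Qed.

Variable R : realType.

Definition cut_form (x : T -> R) : R :=
  - \sum_i \sum_j (e i j)%:R * (x i * x j).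

(** An adjacent ordered pair contributes [1] if it crosses the cut and [-1] otherwise, so the form
    equals four times the cut size minus twice the number of edges. *)
Lemma cut_form_signs_le_surplus (A : {set T}) : simple_graph e ->
  cut_form (fun i => (-1) ^+ (i \in A)) <= 4 * surplus R e.
Proof.
move=> eG; have [e_sym e_irr] := eG.
pose r x y := e x y && ((x \in A) (+) (y \in A)).
have rG : simple_graph r.
  by split=> [x y|x]; rewrite /r ?e_irr // e_sym addbC.
have ce := sum_adjacencyR R eG; have cr := sum_adjacencyR R rG.
have : #|Defs.cut e A|%:R <= (maxcut e)%:R :> R.
  by rewrite ler_nat; exact: (leq_bigmax (F := fun A => #|Defs.cut e A|)).
rewrite cut_edges -/r /surplus.
suff -> : cut_form (fun i => (-1) ^+ (i \in A)) =
  2 * #|edges r|%:R * 2 - 2 * #|edges e|%:R by move=> ?; lra.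
rewrite -cr -ce big_distrl -sumrB /cut_form -sumrN; apply: eq_bigr => i _.
rewrite big_distrl -sumrB -sumrN; apply: eq_bigr => j _.
rewrite /r; case: (e i j); case: (i \in A); case: (j \in A);
  rewrite /= ?expr0 ?expr1; ring.
Qed.

End Cuts.

(** * From sign vectors to real vectors *)

Section Rounding.
Variables (R : realType) (T : finType) (e : rel T).
Hypothesis eG : simple_graph e.

(** Without loops the form is affine in each coordinate, and [x i] is the mean of [1] and [-1] with
    the displayed weights. *)
Lemma cut_form_split (x : T -> R) i (y := fun s j => if j == i then s else x j) :
  cut_form e x =
  (1 + x i) / 2 * cut_form e (y 1) + (1 - x i) / 2 * cut_form e (y (-1)).
Proof.
rewrite /cut_form !mulrN -opprD; congr (- _).
rewrite !big_distrr /= -big_split; apply: eq_bigr => j _ /=.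
rewrite !big_distrr /= -big_split; apply: eq_bigr => k _ /=; rewrite /y.
have [->|_] := eqVneq j i; have [->|_] := eqVneq k i; try by field.
by rewrite eG.2 !mul0r !mulr0 addr0.
Qed.

(** Induction on the number of coordinates that are not signs: [cut_form_split] writes the form as a
    convex combination of two values with one such coordinate fewer. *)
Lemma cut_form_cube_le (x : T -> R) : (forall i, `|x i| <= 1) ->
  cut_form e x <= 4 * surplus R e.
Proof.
have [m] := ubnP #|[set i | (x i != 1) && (x i != -1)]|.
elim: m x => // m IH x; rewrite ltnS => hm x1.
have [i|allsign] := pickP [pred i | (x i != 1) && (x i != -1)]; last first.
  have -> : x = fun i => (-1) ^+ (i \in [set i | x i == -1]).
    apply: boolp.funext => i; rewrite inE.
    by have := allsign i; rewrite /= ; case: eqP => [->|_]; case: eqP => // ->.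
  exact: cut_form_signs_le_surplus.
move=> /= hi; pose y s j := if j == i then s else x j.
have ysmall s : `|s| = 1 -> cut_form e (y s) <= 4 * surplus R e.
  move=> s1; apply: IH; last by move=> j; rewrite /y; case: eqP => // _; rewrite s1.
  apply: leq_trans hm; apply: proper_card; apply/properP; split.
    by apply/subsetP => j; rewrite !inE /y; case: (j =P i) => [->|] // _; exact: hi.
  exists i; rewrite inE // /y eqxx.
  move: s1 => /eqP; rewrite eqr_norml => /andP[/orP[]/eqP-> _];
    by rewrite eqxx ?andbF.
have := ysmall 1 (normr1 _); have := ysmall (-1) (normrN1 _).
rewrite (cut_form_split x i) -/(y 1) -/(y (-1)).
have := x1 i; rewrite ler_norml => /andP[]; nra.
Qed.

Lemma surplus_ge0 : 0 <= surplus R e.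
Proof.
have : cut_form e (fun=> 0) <= 4 * surplus R e.
  by apply: cut_form_cube_le => i; rewrite normr0.
rewrite /cut_form big1 ?oppr0 => [|i _]; first by lra.
by rewrite big1 // => j _; rewrite !mulr0.
Qed.

Lemma cut_form_le (x : T -> R) (m : R) : (forall i, `|x i| <= m) ->
  cut_form e x <= m ^+ 2 * (4 * surplus R e).
Proof.
move=> xm; have [i0 _|T0] := pickP (@predT T); last first.
  rewrite /cut_form big1 ?oppr0; last by move=> i; have := T0 i.
  by apply: mulr_ge0; [exact: sqr_ge0 | apply: mulr_ge0 => //; exact: surplus_ge0].
have m0 : 0 <= m := le_trans (normr_ge0 _) (xm i0).
have [m1|m1] := eqVneq m 0.
  rewrite m1 expr0n mul0r /cut_form big1 ?oppr0// => i _; rewrite big1// => j _.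
  by have := xm i; rewrite m1 normr_le0 => /eqP->; rewrite mul0r mulr0.
have mp : 0 < m by rewrite lt_neqAle eq_sym m1.
have -> : cut_form e x = m ^+ 2 * cut_form e (fun i => x i / m).
  rewrite /cut_form mulrN big_distrr; congr (- _); apply: eq_bigr => i _ /=.
  by rewrite big_distrr; apply: eq_bigr => j _ /=; field.
rewrite ler_wpM2l ?sqr_ge0//; apply: cut_form_cube_le => i.
by rewrite normrM normfV (ger0_norm m0) ler_pdivrMr// mul1r.
Qed.

(** The indicator of [i] minus that of [j] gives the form the value [2]. This bound settles bounded
    [n] and makes the surplus strictly positive. *)
Lemma surplus_ge_half (i j : T) : e i j -> 1 / 2 <= surplus R e.
Proof.
move=> eij; pose x k : R := (k == i)%:R - (k == j)%:R.
have ij : i != j by apply: contraTneq eij => ->; rewrite eG.2.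
have : cut_form e x <= 4 * surplus R e.
  apply: cut_form_cube_le => k; rewrite /x.
  case: eqP => [->|_]; rewrite ?(negbTE ij) ?subr0 ?normr1 //.
  by rewrite sub0r normrN normr_nat lern1 leq_b1.
suff -> : cut_form e x = 2 by lra.
have row (f : T -> R) : \sum_k x k * f k = f i - f j.
  have pick1 l : \sum_k (k == l)%:R * f k = f l.
    rewrite (bigD1 l)//= eqxx mul1r big1 ?addr0// => k /negbTE->.
    by rewrite mul0r.
  by under eq_bigr => k _ do rewrite /x mulrBl; rewrite sumrB !pick1.
have -> : cut_form e x = - \sum_k x k * \sum_l x l * (e k l)%:R.
  rewrite /cut_form; congr (- _); apply: eq_bigr => k _; rewrite big_distrr /=.
  by apply: eq_bigr => l _; ring.
by rewrite row !row !eG.2 (eG.1 j i) eij /=; ring.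
Qed.

End Rounding.

(** * Rounding by random signs *)

Section RandomSigns.
Variables (R : realType) (T K : finType) (V : T -> K -> R).

(** Expectations over random signs are written as sums over all [s], so the number of sign functions
    appears as a factor below. *)
Definition sign_sum (s : {ffun K -> bool}) (i : T) : R :=
  \sum_k (-1) ^+ (s k) * V i k.

Lemma sum_sign_corr (k l : K) :
  \sum_(s : {ffun K -> bool}) (-1) ^+ (s k) * (-1) ^+ (s l) =
  (k == l)%:R * #|{ffun K -> bool}|%:R :> R.
Proof.
have [->|kl] := eqVneq k l.
  rewrite mul1r -sum1_card natr_sum; apply: eq_bigr => s _.
  by case: (s l); rewrite ?expr0 ?expr1 ?mulrNN mulr1.
(* Flipping the sign at [k] is an involution that negates each summand. *)
rewrite mul0r; pose flip (s : {ffun K -> bool}) := [ffun m => s m (+) (m == k)].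
have flipK : involutive flip.
  by move=> s; apply/ffunP => m; rewrite !ffunE -addbA addbb addbF.
have : \sum_(s : {ffun K -> bool}) (-1) ^+ (s k) * (-1) ^+ (s l) =
    - \sum_(s : {ffun K -> bool}) (-1) ^+ (s k) * (-1) ^+ (s l) :> R.
  rewrite [LHS](reindex flip); last exact/onW_bij/inv_bij.
  rewrite -sumrN; apply: eq_bigr => s _.
  rewrite !ffunE eqxx eq_sym (negbTE kl) addbF addbT -mulNr.
  by case: (s k); rewrite /= ?expr0 ?expr1 ?opprK.
by move=> /eqP; rewrite -addr_eq0 -mulr2n mulrn_eq0 => /eqP.
Qed.

Lemma sum_sign_sumM (i j : T) :
  \sum_s sign_sum s i * sign_sum s j = #|{ffun K -> bool}|%:R * gram V i j.
Proof.
transitivity (\sum_(s : {ffun K -> bool}) \sum_k \sum_l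
    (V i k * V j l) * ((-1) ^+ (s k) * (-1) ^+ (s l) : R)).
  apply: eq_bigr => s _; rewrite /sign_sum big_distrl /=; apply: eq_bigr => k _.
  by rewrite big_distrr /=; apply: eq_bigr => l _; ring.
rewrite exchange_big /gram big_distrr /=; apply: eq_bigr => k _.
rewrite exchange_big /= (bigD1 k)//= -big_distrr /= sum_sign_corr eqxx.
rewrite big1 => [|l /negbTE kl]; first by rewrite /=; ring.
by rewrite -big_distrr /= sum_sign_corr eq_sym kl mul0r mulr0.
Qed.

(** From [expR v <= (1 - v)^-1], since [(1 + v + 2 v^2) (1 - v) = 1 + v^2 (1 - 2 v) >= 1]. *)
Lemma expR_le_quadratic (v : R) : `|v| <= 1 / 2 -> expR v <= 1 + v + 2 * v ^+ 2.
Proof.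
rewrite ler_norml => /andP[v1 v2].
rewrite -[v in expR v]opprK expRN.
have h := expR_ge1Dx (- v).
have pos : 0 < 1 + - v by lra.
apply: le_trans (_ : (1 - v)^-1 <= _); first by rewrite lef_pV2 ?posrE ?expR_gt0.
rewrite -[X in X <= _]mul1r ler_pdivrMr//; nra.
Qed.

(** The exponential moment factors over the coordinates, each factor being at most [2 expR (2 v^2)]
    with [v = V i k]; the product of the exponentials is at most [expR (1 / 2) <= 2]. *)
Lemma sum_expR_sign_sum (i : T) : gram V i i <= 1 / 4 ->
  \sum_s expR (sign_sum s i) <= #|{ffun K -> bool}|%:R * 2.
Proof.
move=> Vi.
have Vk k : `|V i k| <= 1 / 2.
  have : V i k * V i k <= 1 / 4.
    apply: le_trans Vi; rewrite /gram (bigD1 k)//= lerDl.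
    by apply: sumr_ge0 => l _; rewrite -expr2 sqr_ge0.
  by rewrite ler_norml => ?; apply/andP; split; nra.
have -> : \sum_s expR (sign_sum s i) =
    \prod_k \sum_(b : bool) expR ((-1) ^+ b * V i k).
  by rewrite bigA_distr_bigA /=; apply: eq_bigr => s _; rewrite /sign_sum expR_sum.
apply: le_trans (_ : \prod_k (2 * expR (2 * (V i k * V i k))) <= _).
  apply: ler_prod => k _; rewrite sumr_ge0 => [|b _]; last exact: expR_ge0.
  rewrite /= big_bool /= expr0 expr1 mul1r mulN1r.
  have h1 := expR_le_quadratic (Vk k).
  have := Vk k; rewrite -normrN => /expR_le_quadratic h2.
  have h3 := expR_ge1Dx (2 * (V i k * V i k)).
  move: h1 h2; rewrite sqrrN expr2; lra.
rewrite big_split /= prodr_const -expR_sum -big_distrr /= -/(gram V i i).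
rewrite card_ffun card_bool natrX ler_wpM2l ?exprn_ge0//.
apply: le_trans (_ : expR (1 / 2) <= _); first by rewrite ler_expR; lra.
have := @expR_le_quadratic (1 / 2); rewrite ger0_norm; last lra.
by move=> /(_ (lexx _)); lra.
Qed.

(** Above the threshold [L], [x^2 <= 2 L^2 + 2 (x - L)^2] and the last square is absorbed by
    [expR (x - L)]. Exponential moments thus control the square. *)
Lemma sqr_le_expR (L x : R) : 0 <= L ->
  x ^+ 2 <= 2 * L ^+ 2 + 4 * (expR (- L) * (expR x + expR (- x))).
Proof.
move=> L0; wlog x0 : x / 0 <= x => [hw|].
  have [|x0] := leP 0 x; first exact: hw.
  by have := hw (- x); rewrite sqrrN opprK [expR (- x) + _]addrC; apply; lra.
have h1 := mulr_ge0 (expR_ge0 (- L)) (expR_ge0 x).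
have h2 := mulr_ge0 (expR_ge0 (- L)) (expR_ge0 (- x)).
rewrite mulrDr; have [xL|xL] := leP x L.
  have : x ^+ 2 <= L ^+ 2 by rewrite ler_sqr ?nnegrE.
  by have := sqr_ge0 L; lra.
have := @expR_ge1Dxn _ (x - L) 1; rewrite subr_ge0 => /(_ (ltW xL)).
rewrite (_ : (2`!)%:R = 2 :> R)// expRD [expR x * _]mulrC => h3.
have : x ^+ 2 <= 2 * L ^+ 2 + 2 * (x - L) ^+ 2 by have := sqr_ge0 (x - 2 * L); lra.
by lra.
Qed.

End RandomSigns.

Section SignRounding.
Variables (R : realType) (T K : finType) (V : T -> K -> R).

Lemma sum_expR_sign_sumN (i : T) : gram V i i <= 1 / 4 ->
  \sum_s expR (- sign_sum V s i) <= #|{ffun K -> bool}|%:R * 2.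
Proof.
move=> Vi; have -> : \sum_s expR (- sign_sum V s i) =
    \sum_s expR (sign_sum (fun i k => - V i k) s i).
  apply: eq_bigr => s _; congr expR; rewrite -sumrN.
  by apply: eq_bigr => k _; rewrite mulrN.
apply: sum_expR_sign_sum; apply: le_trans Vi.
by rewrite /gram; under eq_bigr => k _ do rewrite mulrNN.
Qed.

(** The left side is the average of [cut_form] over the vectors [sign_sum V s], and each value is at
    most the largest squared entry times four surpluses. *)
Lemma gram_cut_form_le (e : rel T) (L : R) : simple_graph e -> 0 <= L ->
  (forall i, gram V i i <= 1 / 4) ->
  - \sum_i \sum_j (e i j)%:R * gram V i j <=
  (2 * L ^+ 2 + 16 * #|T|%:R * expR (- L)) * (4 * surplus R e).
Proof.
move=> eG L0 Vle; set N : R := #|{ffun K -> bool}|%:R.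
have N0 : 0 < N by rewrite /N card_ffun card_bool natrX exprn_gt0.
(* The sum of the exponentials over all vertices stands in for their maximum; its average is at most
   [4 #|T|]. *)
pose Q s := 2 * L ^+ 2 +
  4 * (expR (- L) * \sum_i (expR (sign_sum V s i) + expR (- sign_sum V s i))).
have Qge s i : sign_sum V s i ^+ 2 <= Q s.
  apply: le_trans (sqr_le_expR _ L0) _; rewrite lerD2l ler_wpM2l//.
  rewrite ler_wpM2l ?expR_ge0// (bigD1 i)//= lerDl sumr_ge0// => j _.
  by rewrite addr_ge0 ?expR_ge0.
have cutQ s : cut_form e (sign_sum V s) <= Q s * (4 * surplus R e).
  have [i0 _|T0] := pickP (@predT T); last first.
    rewrite /cut_form big1 ?oppr0; last by move=> i; have := T0 i.
    rewrite /Q big1 ?mulr0 ?addr0; last by move=> i; have := T0 i.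
    have := surplus_ge0 R eG; have := sqr_ge0 L; nra.
  have Q0 : 0 <= Q s := le_trans (sqr_ge0 _) (Qge s i0).
  rewrite -[Q s]sqr_sqrtr//; apply: cut_form_le => // i.
  by rewrite -sqrtr_sqr ler_wsqrtr.
have sumE : N * - \sum_i \sum_j (e i j)%:R * gram V i j =
    \sum_s cut_form e (sign_sum V s).
  rewrite /cut_form sumrN mulrN; congr (- _).
  rewrite big_distrr [RHS]exchange_big /=; apply: eq_bigr => i _.
  rewrite big_distrr [RHS]exchange_big /=; apply: eq_bigr => j _.
  by rewrite -big_distrr /= sum_sign_sumM -/N; ring.
rewrite -(ler_pM2l N0) sumE [X in _ <= X]mulrA.
apply: le_trans (ler_sum _ (fun s _ => cutQ s)) _; rewrite -big_distrl /=.
apply: ler_wpM2r; first by rewrite mulr_ge0 ?surplus_ge0.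
rewrite /Q big_split /= sumr_const -[_ *+ #|_|]mulr_natl -/N mulrDr lerD2l.
rewrite -big_distrr -big_distrr exchange_big /=.
have sumle : \sum_i \sum_s (expR (sign_sum V s i) + expR (- sign_sum V s i))
    <= #|T|%:R * (4 * N).
  rewrite mulr_natl -sumr_const; apply: ler_sum => i _; rewrite big_split /=.
  have := sum_expR_sign_sum (Vle i); have := sum_expR_sign_sumN (Vle i).
  by rewrite -/N; lra.
have := ler_wpM2l (expR_ge0 (- L)) sumle; lra.
Qed.

End SignRounding.

(** * Regular graphs *)

Section RegularDeviation.
Variables (R : realType) (T : finType) (e : rel T) (d : nat).
Hypotheses (eG : simple_graph e) (ereg : regular e d) (T0 : (0 < #|T|)%N).
Local Notation n := (#|T|%:R : R).

(** The successor counts the diagonal entry, so that the rows of [deviation] sum to [0]. *)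
Definition density : R := d.+1%:R / n.

(* For the complementary graph of density [1 - density], this is its
   adjacency matrix recentred to have vanishing row sums. *)
Definition deviation (i j : T) : R := density - (i == j)%:R - (e i j)%:R.

Lemma natr_card_gt0 : 0 < n.
Proof. by rewrite ltr0n. Qed.

Lemma sum_eqr (i : T) (F : T -> R) : \sum_j (i == j)%:R * F j = F i.
Proof.
rewrite (bigD1 i)//= eqxx mul1r big1 ?addr0// => j.
by rewrite eq_sym => /negbTE->; rewrite mul0r.
Qed.

Lemma deviation_sym i j : deviation i j = deviation j i.
Proof. by rewrite /deviation eq_sym eG.1. Qed.

Lemma deviation_row i : \sum_j deviation i j = 0.
Proof.
rewrite /deviation !sumrB sumr_const -mulr_natr /density divfK ?gt_eqF ?natr_card_gt0//.
have -> : \sum_j (i == j)%:R = 1 :> R.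
  by rewrite -[RHS](sum_eqr i (fun=> 1)); apply: eq_bigr => j _; rewrite mulr1.
have -> : \sum_j (e i j)%:R = d%:R :> R.
  rewrite -(ereg i) -sum1dep_card natr_sum [RHS]big_mkcond /=.
  by apply: eq_bigr => j _; case: (e i j).
by rewrite -natr1; ring.
Qed.

Lemma sum_sqr_mean (f : T -> R) (m := (\sum_i f i) / n) :
  n * m ^+ 2 <= \sum_i f i ^+ 2.
Proof.
have : 0 <= \sum_i (f i - m) ^+ 2 by apply: sumr_ge0 => i _; exact: sqr_ge0.
under eq_bigr => i _ do rewrite sqrrB.
rewrite big_split sumrB /= sumr_const -[_ *+ #|_|]mulr_natl.
have -> : \sum_i f i * m *+ 2 = 2 * (n * m) * m.
  have -> : n * m = \sum_i f i by rewrite mulrC divfK ?gt_eqF ?natr_card_gt0.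
  rewrite -mulrA big_distrl big_distrr /=.
  by apply: eq_bigr => i _; rewrite mulr_natl.
lra.
Qed.

(** Centering leaves the left side unchanged because the rows of [deviation] sum to [0]. For
    centered vectors the constant part contributes [0] and the identity part is nonpositive, leaving
    the adjacency form. *)
Lemma deviation_gram_le (K : finType) (V : T -> K -> R) (L D : R) :
  0 <= L -> 0 < D -> (forall i, gram V i i <= D) ->
  \sum_i \sum_j deviation i j * gram V i j <=
  D * (16 * ((2 * L ^+ 2 + 16 * n * expR (- L)) * (4 * surplus R e))).
Proof.
move=> L0 D0 VD; pose m k := (\sum_i V i k) / n.
(* Centered vectors have squared norm at most [4 D], so scaling by [c] reaches the required [1 / 4];
   undoing it costs the factor [16 D]. *)
pose Y i k := V i k - m k; pose c := (4 * Num.sqrt D)^-1.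
have n0 := natr_card_gt0.
have c2 : c ^+ 2 = (16 * D)^-1.
  by rewrite /c exprVn exprMn sqr_sqrtr ?ltW//; congr (_^-1); ring.
have Ycol k : \sum_i Y i k = 0.
  by rewrite sumrB sumr_const -[_ *+ #|_|]mulr_natr divfK ?subrr ?gt_eqF.
have gramW i j : gram (fun i k => c * Y i k) i j = c ^+ 2 * gram Y i j.
  by rewrite /gram big_distrr; apply: eq_bigr => k _ /=; ring.
have msq : \sum_k m k ^+ 2 <= D.
  rewrite -(ler_pM2l n0) big_distrr /=.
  apply: le_trans (_ : \sum_k \sum_i V i k ^+ 2 <= _).
    by apply: ler_sum => k _; exact: sum_sqr_mean.
  rewrite exchange_big mulr_natl -sumr_const /=; apply: ler_sum => i _.
  by apply: le_trans (VD i); rewrite /gram; apply: ler_sum => k _; rewrite expr2.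
have gramY i : gram Y i i <= 4 * D.
  have : gram Y i i <= 2 * gram V i i + 2 * \sum_k m k ^+ 2.
    rewrite /gram !big_distrr -big_split /=; apply: ler_sum => k _; rewrite /Y.
    by have := sqr_ge0 (V i k + m k); lra.
  by have := VD i; lra.
have := @gram_cut_form_le _ _ _ (fun i k => c * Y i k) e L eG L0.
set B := _ * (4 * _); have W4 i : gram (fun i k => c * Y i k) i i <= 1 / 4.
  by rewrite gramW c2 mulrC ler_pdivrMr ?mulr_gt0//; have := gramY i; lra.
move=> /(_ W4).
have -> : \sum_i \sum_j (e i j)%:R * gram (fun i k => c * Y i k) i j =
    c ^+ 2 * \sum_i \sum_j (e i j)%:R * gram Y i j.
  rewrite big_distrr; apply: eq_bigr => i _; rewrite big_distrr.
  by apply: eq_bigr => j _; rewrite gramW /=; ring.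
rewrite c2 -mulrN mulrC ler_pdivrMr ?mulr_gt0// => le_B.
have rowY i : \sum_j gram Y i j = 0.
  rewrite /gram exchange_big big1 //= => k _.
  by rewrite -big_distrr /= Ycol mulr0.
have VY : \sum_i \sum_j deviation i j * gram V i j =
          \sum_i \sum_j deviation i j * gram Y i j.
  have gramVY i j : gram V i j =
      gram Y i j + \sum_k m k * Y i k + \sum_k m k * V j k.
    rewrite /gram -!big_split; apply: eq_bigr => k _ /=; rewrite /Y; ring.
  transitivity (\sum_i \sum_j deviation i j * gram Y i j
     + \sum_i \sum_j deviation i j * (\sum_k m k * Y i k)
     + \sum_j \sum_i deviation j i * (\sum_k m k * V j k)); last first.
    rewrite [X in _ + X + _]big1 => [|i _]; last first.
      by rewrite -big_distrl /= deviation_row mul0r.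
    rewrite [X in _ + X]big1 => [|i _]; last first.
      by rewrite -big_distrl /= deviation_row mul0r.
    by rewrite !addr0.
  rewrite [X in _ + X]exchange_big /= -!big_split; apply: eq_bigr => i _ /=.
  rewrite -!big_split; apply: eq_bigr => j _ /=.
  by rewrite gramVY (deviation_sym j i); ring.
rewrite VY.
have -> : \sum_i \sum_j deviation i j * gram Y i j =
    - \sum_i gram Y i i - \sum_i \sum_j (e i j)%:R * gram Y i j.
  rewrite -sumrN -sumrB; apply: eq_bigr => i _.
  rewrite -[in RHS](sum_eqr i) -sumrN -sumrB.
  transitivity (\sum_j (density * gram Y i j +
     (- ((i == j)%:R * gram Y i j) - (e i j)%:R * gram Y i j))).
    by apply: eq_bigr => j _; rewrite /deviation; ring.
  by rewrite big_split -big_distrr /= rowY mulr0 add0r.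
have : 0 <= \sum_i gram Y i i.
  by apply: sumr_ge0 => i _; apply: sumr_ge0 => k _; rewrite -expr2 sqr_ge0.
by lra.
Qed.

End RegularDeviation.

(** * Two-valued matrices with vanishing row sums *)

(** Third moment of a mean-zero variable with values [rho] and [rho - 1]; for [0 < rho < 1] it is
    positive exactly when [rho > 1 / 2]. *)
Definition cube_excess (R : realType) (rho : R) : R :=
  (2 * rho - 1) * (rho * (1 - rho)).

Section TwoValuedMatrix.
Variables (R : realType) (T : finType) (N : T -> T -> R) (rho B : R).
Hypotheses (T0 : (0 < #|T|)%N) (N_sym : forall i j, N i j = N j i).
Hypothesis N_row : forall i, \sum_j N i j = 0.
Hypothesis N_val : forall i j, N i j = rho \/ N i j = rho - 1.
Hypothesis N_diag : forall i, N i i = rho - 1.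
Hypotheses (rho_gt : 1 / 2 < rho) (rho_lt : rho < 1) (B0 : 0 < B).
Hypothesis N_gram_le : forall (K : finType) (V : T -> K -> R) (D : R),
  0 < D -> (forall i, gram V i i <= D) ->
  \sum_i \sum_j N i j * gram V i j <= D * B.
Local Notation n := (#|T|%:R : R).

Local Notation kap := (cube_excess rho).

Lemma cube_excess_gt0 : 0 < kap.
Proof.
have r1 := rho_gt; have r2 := rho_lt.
by apply: mulr_gt0; [lra | apply: mulr_gt0; lra].
Qed.

Lemma cube_excess_le1 : kap <= 1.
Proof.
have r1 := rho_gt; have r2 := rho_lt.
have h : rho * (1 - rho) <= 1 by nra.
have h0 : 0 <= rho * (1 - rho) by nra.
by rewrite /cube_excess; nra.
Qed.

Lemma sum_cube_two_valued : \sum_i \sum_j N i j ^+ 3 = kap * n ^+ 2.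
Proof.
(* On the two values the cube agrees with an affine function, whose linear part is killed by the row
   sums. *)
have cubeE i j : N i j ^+ 3 = ((2 * rho - 1) ^+ 2 + rho * (1 - rho)) * N i j + kap.
  by rewrite /cube_excess; case: (N_val i j) => ->; ring.
transitivity (\sum_(i : T) n * kap).
  apply: eq_bigr => i _; under eq_bigr => j _ do rewrite cubeE.
  by rewrite big_split -big_distrr /= N_row mulr0 add0r sumr_const mulr_natl.
by rewrite sumr_const -[_ *+ #|_|]mulr_natl; ring.
Qed.

Lemma two_valued_norm_le i j : -1 <= N i j <= 1.
Proof.
have r1 := rho_gt; have r2 := rho_lt.
by apply/andP; case: (N_val i j) => ->; split; lra.
Qed.

Lemma sum_constR (c : R) : \sum_(i : T) \sum_(j : T) c = n ^+ 2 * c.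
Proof. by rewrite !sumr_const -mulrnA -[_ *+ (_ * _)]mulr_natl natrM expr2. Qed.

(** The alternatives correspond to a small and a large inner product of [N] with its positive part.
    [H] caps the diagonal of that part on the retained indices. *)
Lemma gram_two_valued_dichotomy (M := 256 / kap ^+ 2) (H := M * B / n) :
  kap / 2 * n ^+ 2 <= (H + 1) ^+ 2 * B \/ kap ^+ 2 / 256 * n ^+ 2 <= H * B.
Proof.
have [K [V [W [P [NE frob P1 trP]]]]] := symmetric_spectral_parts N_sym.
have r1 := rho_gt; have r2 := rho_lt.
have n0 : 0 < n by rewrite ltr0n.
have k0 := cube_excess_gt0; have k1 := cube_excess_le1.
have M0 : 0 < M by apply: divr_gt0; [exact: ltr0n | exact: exprn_gt0].
have H0 : 0 < H by apply: divr_gt0 => //; exact: mulr_gt0.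
have gram_ge0 (K' : finType) (V' : T -> K' -> R) i : 0 <= gram V' i i.
  by apply: sumr_ge0 => k _; rewrite -expr2 sqr_ge0.
have trV : \sum_i gram V i i <= B.
  by rewrite -trP -[B]mul1r; apply: N_gram_le.
(* The diagonal of [gram V] has average at most [B / n], so at most [n / M] indices exceed
   [H = M * B / n]. Below, [S] counts the pairs with a discarded index. *)
pose good i := gram V i i <= H; pose u i : R := (good i)%:R.
have u01 i : u i = 0 \/ u i = 1 by rewrite /u; case: (good i); [right|left].
have bad_le : M * \sum_i (1 - u i) <= n.
  rewrite -(ler_pM2r (divr_gt0 B0 n0)).
  have -> : n * (B / n) = B by rewrite mulrC divfK ?gt_eqF.
  apply: le_trans trV; rewrite mulrAC big_distrr /=; apply: ler_sum => i _.
  rewrite mulrA -/H /u; have [//|] := boolP (good i).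
    by move=> _; rewrite subrr mulr0.
  by rewrite /good -ltNge subr0 mulr1 => /ltW.
have bad2_le : M * \sum_i \sum_j (1 - u i * u j) <= 2 * n ^+ 2.
  apply: le_trans (_ : M * \sum_i \sum_j ((1 - u i) + (1 - u j)) <= _).
    apply: ler_wpM2l; first exact: ltW.
    apply: ler_sum => i _; apply: ler_sum => j _.
    by case: (u01 i) => ->; case: (u01 j) => ->; lra.
  under eq_bigr => i _ do rewrite big_split /= sumr_const -[_ *+ #|_|]mulr_natl.
  rewrite big_split /= sumr_const -[_ *+ #|_|]mulr_natl -big_distrr /=.
  by have := ler_wpM2l (ltW n0) bad_le; lra.
set S := \sum_i \sum_j (1 - u i * u j) in bad2_le.
have S_le : S <= kap ^+ 2 / 128 * n ^+ 2.
  rewrite -(ler_pM2l M0); apply: le_trans bad2_le _.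
  by rewrite /M le_eqVlt; apply/orP; left; apply/eqP; field; rewrite gt_eqF.
set I := \sum_i \sum_j N i j * gram V i j in frob.
set F := \sum_i \sum_j gram V i j ^+ 2 in frob.
have [I_ge|I_lt] := leP (kap ^+ 2 / 64 * n ^+ 2) I; [right|left].
  have gE i j : gram (fun i k => u i * V i k) i j = u i * u j * gram V i j.
    by rewrite /gram big_distrr; apply: eq_bigr => k _ /=; ring.
  have diag i : gram (fun i k => u i * V i k) i i <= H.
    rewrite gE /u; case: (boolP (good i)) => h; first by rewrite !mul1r.
    by rewrite !mul0r ltW.
  have := N_gram_le H0 diag.
  (* A discarded pair loses at most half the sum of the squares of the two entries. As [F <= I], at
     least [(I - S) / 2] remains. *)
  have : I - (S / 2 + F / 2) <=
      \sum_i \sum_j N i j * gram (fun i k => u i * V i k) i j.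
    rewrite /I /S /F !big_distrl -big_split -sumrB /=; apply: ler_sum => i _.
    rewrite !big_distrl -big_split -sumrB /=; apply: ler_sum => j _.
    rewrite gE; have /andP[] := two_valued_norm_le i j.
    move: (N i j) (gram V i j) => x y x1 x2.
    have x2_le : x ^+ 2 <= 1 by rewrite expr2; nra.
    have xy := sqr_ge0 (x - y); have y2 := sqr_ge0 y.
    by case: (u01 i) => ->; case: (u01 j) => ->; lra.
  by lra.
(* Tensor squares of the rows of [W] realize the entrywise square as a Gram matrix. *)
have gE i j : gram (fun i (k : K * K) => u i * (W i k.1 * W i k.2)) i j =
    u i * u j * gram W i j ^+ 2.
  rewrite /gram expr2 big_distrlr /= pair_big big_distrr /=.
  by apply: eq_bigr => k _; ring.
have H1 : 0 < (H + 1) ^+ 2 by rewrite exprn_gt0//; lra.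
have diag i : gram (fun i (k : K * K) => u i * (W i k.1 * W i k.2)) i i <=
    (H + 1) ^+ 2.
  rewrite gE /u; case: (boolP (good i)) => h; last by rewrite !mul0r ltW.
  rewrite !mul1r.
  rewrite ler_sqr ?nnegrE//; last by lra.
  by move: h (NE i i); rewrite N_diag /good; lra.
apply: le_trans (N_gram_le H1 diag).
(* With [Z = Y - N], expanding [N Z^2] leaves [N^3] up to [2 |Y| + Y^2], and [2 |Y| <= g + Y^2 / g].
   This [g] bounds both resulting sums by [kap / 8 * n ^+ 2], and all errors together stay below
   [kap / 2 * n ^+ 2]. *)
pose g := kap / 8; have g0 : 0 < g by rewrite divr_gt0.
have : \sum_i \sum_j N i j ^+ 3 - (F + \sum_(i : T) \sum_(j : T) g + F / g + S) <=
    \sum_i \sum_j N i j * gram (fun i (k : K * K) => u i * (W i k.1 * W i k.2)) i j.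
  rewrite /S /F !big_distrl -!big_split -sumrB /=; apply: ler_sum => i _.
  rewrite !big_distrl -!big_split -sumrB /=; apply: ler_sum => j _.
  rewrite gE; have -> : gram W i j = gram V i j - N i j by rewrite NE; ring.
  have /andP[] := two_valued_norm_le i j.
  have : 2 * `|gram V i j| <= g + gram V i j ^+ 2 / g.
    rewrite -(ler_pM2r g0) [X in _ <= X]mulrDl divfK ?gt_eqF//.
    have := sqr_ge0 (`|gram V i j| - g); rewrite sqrrB real_normK ?num_real//.
    by lra.
  have := ler_norm (gram V i j); have := normr_ge0 (gram V i j).
  move: (gram V i j ^+ 2 / g) => q.
  move: (N i j) (gram V i j) => x y; set z := `|y| => z0 yz zq x1 x2.
  have x2_le : 0 <= x ^+ 2 <= 1 by rewrite sqr_ge0 expr2; nra.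
  have x3_le : x ^+ 3 <= 1 by rewrite exprS; nra.
  have y2 : 0 <= y ^+ 2 by exact: sqr_ge0.
  have h1 : x ^+ 2 * y <= z by nra.
  have h2 : - y ^+ 2 <= x * y ^+ 2 by nra.
  by case: (u01 i) => ->; case: (u01 j) => ->; lra.
rewrite sum_cube_two_valued sum_constR => h.
apply: le_trans h.
have Fg : F / g <= kap / 8 * n ^+ 2.
  rewrite ler_pdivrMr//; apply: le_trans frob _; apply: le_trans (ltW I_lt) _.
  by rewrite /g le_eqVlt; apply/orP; left; apply/eqP; field.
have F_le : F <= kap / 64 * n ^+ 2.
  apply: le_trans frob _; apply: le_trans (ltW I_lt) _.
  by have := sqr_ge0 n; rewrite expr2; nra.
have S_le' : S <= kap / 128 * n ^+ 2.
  apply: le_trans S_le _.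
  by have := sqr_ge0 n; rewrite expr2; nra.
have kn : 0 <= kap * n ^+ 2 by rewrite mulr_ge0 ?sqr_ge0 ?ltW.
by move: Fg; set q := F / g => Fg; rewrite /g; lra.
Qed.

(** With [y = n^(1/12)] all exponents become integers. If the bound failed, then [H < y ^+ 4], and
    both alternatives of the dichotomy would fall short of their multiples of [n^2 = y^24]. *)
Lemma two_valued_gram_bound (y : R) : 1 <= y -> y ^+ 12 = n ->
  kap ^+ 2 / 256 * y ^+ 16 <= B.
Proof.
move=> y1 yn; have k0 := cube_excess_gt0; have k1 := cube_excess_le1.
have B_gt0 := B0.
have y0 : 0 < y by lra.
have y4 : 1 <= y ^+ 4 by exact: exprn_ege1.
have [//|B_lt] := leP _ B; exfalso.
have := gram_two_valued_dichotomy; rewrite -yn /=.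
set H := _ * B / _.
have H0 : 0 < H.
  apply: divr_gt0; last exact: exprn_gt0.
  by apply: mulr_gt0 => //; apply: divr_gt0; [exact: ltr0n | exact: exprn_gt0].
have H_lt : H < y ^+ 4.
  rewrite /H ltr_pdivrMr ?exprn_gt0// -exprD.
  rewrite mulrAC ltr_pdivrMr ?exprn_gt0//; move: B_lt; lra.
have y24 : (y ^+ 12) ^+ 2 = y ^+ 4 * y ^+ 4 * y ^+ 16 by ring.
have y16 : 0 < y ^+ 16 by rewrite exprn_gt0.
rewrite y24; set p := y ^+ 4 in H_lt y4 *; set q := y ^+ 16 in B_lt y16 *.
have ppq : 0 < p * p * q by rewrite !mulr_gt0// (lt_le_trans _ y4).
case.
  apply/negP; rewrite -ltNge.
  have h1 : (H + 1) ^+ 2 <= 4 * (p * p) by rewrite expr2; nra.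
  apply: le_lt_trans (_ : 4 * (p * p) * B < _).
    by apply: ler_wpM2r => //; exact: ltW.
  have pp : 0 < 4 * (p * p) by nra.
  have kk : kap ^+ 2 <= kap by rewrite expr2; nra.
  have := ler_wpM2r (ltW ppq) kk; have := mulr_gt0 k0 ppq.
  by have := B_lt; rewrite -(ltr_pM2l pp); lra.
apply/negP; rewrite -ltNge.
apply: lt_le_trans (_ : p * (kap ^+ 2 / 256 * q) <= _).
  by apply: ltr_pM => //; exact: ltW.
have k2 : 0 <= kap ^+ 2 / 256 by rewrite divr_ge0 ?sqr_ge0.
have pq : p * q <= p * p * q by nra.
by have := ler_wpM2l k2 pq; lra.
Qed.

End TwoValuedMatrix.

(** * Choice of constants and conclusion *)

Theorem theorem1p5 (R : realType) (eps : R) (heps : 0 < eps) :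
  exists c : R, 0 < c /\
    forall (T : finType) (e : rel T) (n d : nat),
      simple_graph e -> #|T| = n -> regular e d ->
      (1 / 2 + eps) * n%:R <= d%:R -> d%:R <= (1 - eps) * n%:R ->
      c * (n%:R `^ (5 / 4)) / ln n%:R <= surplus R e.
Proof.
have e4 : 0 < eps ^+ 4 by exact: exprn_gt0.
have e2 : 0 < eps ^+ 2 by exact: exprn_gt0.
(* [c2] serves the case [eps * n < 2]. In [c1], [1024] comes from the lower bound on [B], [4224]
   from [B <= 4224 l^2] times the surplus, and [12] from [l <= 12 y]. *)
pose c1 := eps ^+ 4 / (1024 * 4224 * 12); pose c2 := eps ^+ 2 / 16.
have c10 : 0 < c1 by rewrite /c1; lra.
have c20 : 0 < c2 by rewrite /c2; lra.
exists (Num.min c1 c2); split; first by rewrite lt_min c10 c20.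
set c := Num.min c1 c2.
have cc1 : c <= c1 by rewrite ge_min lexx.
have cc2 : c <= c2 by rewrite ge_min lexx orbT.
have c0 : 0 < c by rewrite lt_min c10 c20.
move=> T e n d eG Tn ereg dlow dupp.
have s0 := surplus_ge0 R eG.
have [n2|n2] := ltnP n 2.
  apply: le_trans s0; apply: mulr_ge0_le0.
    by apply: mulr_ge0; [exact: ltW | exact: powR_ge0].
  by rewrite invr_le0; apply: ln_le0; rewrite lern1.
have n0 : (0 < n)%N by exact: leq_trans n2.
have n0R : 0 < n%:R :> R by rewrite ltr0n.
have n2R : 2 <= n%:R :> R by rewrite (ler_nat _ 2).
pose y : R := n%:R `^ (1 / 12).
have yX m (r : R) : r = 1 / 12 * m%:R -> n%:R `^ r = y ^+ m.
  by move=> ->; rewrite powRrM powR_mulrn ?powR_ge0.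
have y12 : y ^+ 12 = n%:R.
  by rewrite -(yX 12 1) ?powRr1 ?ltW//; field.
rewrite (yX 15); last by field.
have y1 : 1 <= y.
  by rewrite -(powRr0 n%:R); apply: ler_powR; lra.
have y0 : 0 < y by lra.
have l_half : 1 / 2 <= ln n%:R :> R.
  rewrite -(expRK (1 / 2)) ler_ln ?posrE ?expR_gt0//; apply: le_trans n2R.
  have := @expR_le_quadratic R (1 / 2); rewrite ger0_norm; last by lra.
  by move=> /(_ (lexx _)); lra.
have l_le : ln n%:R <= 12 * y.
  by rewrite -y12 lnXn// -[ln y *+ 12]mulr_natl ler_wpM2l// ltW// ln_sublinear.
set l := ln n%:R in l_half l_le *.
have l0 : 0 < l by lra.
have [u _] : exists u : T, true.
  have : (0 < #|T|)%N by rewrite Tn.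
  by rewrite -cardsT => /card_gt0P[u _]; exists u.
have [v euv] : exists v, e u v.
  have : (0 < #|[set v | e u v]|)%N.
    rewrite ereg -(ltr0n R); apply: lt_le_trans dlow.
    by apply: mulr_gt0 => //; lra.
  by case/card_gt0P => v; rewrite inE; exists v.
have s_half := surplus_ge_half R eG euv.
rewrite ler_pdivrMr//.
have y15 : 0 < y ^+ 15 by exact: exprn_gt0.
(* For [eps * n < 2] the surplus bound [1 / 2] suffices. Otherwise the extra [1 / n] in [rho] is at
   most [eps / 2], which keeps [rho] away from [1]. *)
have [n_small|n_large] := ltP (eps * n%:R) 2.
  have ny : y ^+ 15 <= n%:R ^+ 2.
    by rewrite -y12 -exprM ler_weXn2l.
  have n_sq : eps ^+ 2 * n%:R ^+ 2 <= 4.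
    by rewrite -exprMn; have := mulr_gt0 heps n0R; nra.
  have h1 : c * y ^+ 15 <= c2 * n%:R ^+ 2.
    by apply: ler_pM => //; exact: ltW.
  have h2 : 1 / 2 * (1 / 2) <= surplus R e * l by apply: ler_pM => //; lra.
  by move: h1 n_sq h2; rewrite /c2; lra.
have T0 : (0 < #|T|)%N by rewrite Tn.
pose rho := density R T d.
have rhoE : rho * n%:R = d%:R + 1.
  by rewrite /rho /density Tn divfK ?gt_eqF// natr1.
have rho_low : 1 / 2 + eps <= rho by rewrite -(ler_pM2r n0R) rhoE; lra.
have rho_upp : rho <= 1 - eps / 2 by rewrite -(ler_pM2r n0R) rhoE; lra.
(* The threshold [L = ln n] makes [n * expR (- L)] equal to [1]. *)
pose B := 16 * ((2 * l ^+ 2 + 16 * #|T|%:R * expR (- l)) * (4 * surplus R e)).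
have BE : B = 128 * (l ^+ 2 + 8) * surplus R e.
  by rewrite /B Tn expRN lnK ?posrE// -mulrA divff ?gt_eqF//; ring.
have l2 : 0 <= l ^+ 2 by exact: sqr_ge0.
have B0 : 0 < B by rewrite BE; apply: mulr_gt0; lra.
have devval i j : deviation R e d i j = rho \/ deviation R e d i j = rho - 1.
  rewrite /deviation -/rho; have [->|_] := eqVneq i j.
    by right; rewrite eG.2 subr0.
  by case: (e i j); [right | left]; rewrite !subr0.
have devdiag i : deviation R e d i i = rho - 1.
  by rewrite /deviation eqxx eG.2 subr0.
have rho_gt : 1 / 2 < rho by lra.
have rho_lt : rho < 1 by lra.
have := @two_valued_gram_bound R T (deviation R e d) rho B T0
  (deviation_sym R d eG) (deviation_row R ereg T0) devval devdiag rho_gt rho_lt B0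
  (fun K V D D0 VD => deviation_gram_le eG ereg T0 (ltW l0) D0 VD) y y1.
rewrite Tn => /(_ y12) main.
have kap_low : eps ^+ 2 / 2 <= cube_excess rho.
  have h1 : eps / 4 <= rho * (1 - rho) by nra.
  have h2 : 2 * eps <= 2 * rho - 1 by lra.
  rewrite /cube_excess.
  have := @ler_pM R (2 * eps) (2 * rho - 1) (eps / 4) (rho * (1 - rho)).
  move=> /(_ _ _ h2 h1) h3; apply: le_trans (h3 _ _); lra.
have kap2 : eps ^+ 4 / 1024 * y ^+ 16 <= B.
  apply: le_trans main; apply: ler_wpM2r; first by rewrite exprn_ge0 // ltW.
  have : (eps ^+ 2 / 2) ^+ 2 <= cube_excess rho ^+ 2.
    by rewrite ler_sqr ?nnegrE//; lra.
  by lra.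
have B_le : B <= 4224 * (l * l) * surplus R e.
  by rewrite BE; apply: ler_wpM2r => //; nra.
have sl : 0 <= surplus R e * l by apply: mulr_ge0 => //; exact: ltW.
(* One of the two logarithms is traded for [12 y]; cancelling [y] turns the exponent [16] into [15],
   that is [n^(4/3)] into [n^(5/4)]. *)
have h := ler_wpM2l sl l_le.
have : c1 * y ^+ 15 * y <= surplus R e * l * y.
  by move: kap2 B_le h; rewrite /c1 (exprSr y 15); lra.
rewrite ler_pM2r// => h'; apply: le_trans h'.
by apply: ler_wpM2r => //; exact: ltW.
Qed.
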